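(* Let $F=F(X)$ be the free group freely generated by a finite set $X$ and let $\pi\colon(X^{\pm1})^*\to F$ be the natural monoid epimorphism. Let $\mathcal{R}=\{(xx^{-1},\epsilon),(x^{-1}x,\epsilon)\mid x\in X\}$, where $\epsilon$ is the empty word. Then the rewriting system $(X^{\pm1},\mathcal{R})$ is a finite complete rewriting system for $F$. Moreover, if $\{F_\alpha\}_{\alpha\in A}$ is a finite collection of finitely generated subgroups of $F$, then the rewriting system $(X^{\pm1},\mathcal{R})$ is left and right compatible with $\{F_\alpha\}_{\alpha\in A}$.
   Context: Rewriting systems. A rewriting system is a pair $(Y,\mathcal{R})$ with $Y$ a finite set and $\mathcal{R}\subseteq Y^*\times Y^*$, where $Y^*$ is the free monoid on $Y$. Write $x\to_{\mathcal{R}}y$ if $x=x_1ux_2$, $y=x_1vx_2$ for some $(u,v)\in\mathcal{R}$, and let $\to^*_{\mathcal{R}}$ be the reflexive transitive closure. A word $x$ is irreducible if there is no $y\neq x$ with $x\to_{\mathcal{R}}y$. The system is finite if $Y$ and $\mathcal{R}$ are finite; terminating if there is no infinite chain $x_0\to_{\mathcal{R}}x_1\to_{\mathcal{R}}\cdots$; confluent if whenever $x\to^*_{\mathcal{R}}y$ and $x\to^*_{\mathcal{R}}z$ there is $\bar x$ with $y\to^*_{\mathcal{R}}\bar x$ and $z\to^*_{\mathcal{R}}\bar x$; complete if terminating and confluent. It is a finite complete rewriting system for a group $G$ if it is finite and complete and the monoid with presentation $\langle Y\mid\mathcal{R}\rangle$ is isomorphic to $G$; then $\pi\colon Y^*\to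 G$ denotes the corresponding monoid epimorphism. Compatibility. Let $(Y,\mathcal{R})$ be a finite complete rewriting system for $G$ and $\{G_\alpha\}_{\alpha\in A}$ a collection of finitely generated subgroups of $G$. Then $(Y,\mathcal{R})$ is left compatible with $\{G_\alpha\}_{\alpha\in A}$ if for each $\alpha$ there are a finite set $Y_\alpha$, a monoid epimorphism $\pi_\alpha\colon Y_\alpha^*\to G_\alpha\leqslant G$, and a finite set $\mathcal{R}_\alpha$ of rewriting rules over the alphabet $Y\cup Y_\alpha\cup\{t_\alpha\}$, where $t_\alpha$ is a new letter, such that: (1) the rewriting system $(Y\cup Y_\alpha\cup\{t_\alpha\},\mathcal{R}\cup\mathcal{R}_\alpha)$ is terminating; (2) each rule in $\mathcal{R}_\alpha$ is of the form $(t_\alpha u,vt_\alpha w)$ with $u,w\in Y^*$, $v\in Y_\alpha^*$ and $\pi(u)=\pi_\alpha(v)\pi(w)$; (3) if $t_\alpha u$ and $t_\alpha v$ are irreducible for $(Y\cup Y_\alpha\cup\{t_\alpha\},\mathcal{R}\cup\mathcal{R}_\alpha)$ with $u,v\in Y^*$, then $u=v$ if and only if $G_\alpha\cdot\pi(u)=G_\alpha\cdot\pi(v)$. Right compatibility is defined in the mirror-image way: rules in $\mathcal{R}_\alpha$ have the form $(ut_\alpha,wt_\alpha v)$ with $u,w\in Y^*$, $v\in Y_\alpha^*$ and $\pi(u)=\pi(w)\pi_\alpha(v)$, and in (3) one requires that for irreducible $ut_\alpha$, $vt_\alpha$ with $u,v\in Y^*$, $u=v$ if and only if $\pi(u)\cdot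 G_\alpha=\pi(v)\cdot G_\alpha$. *)

(* Defs.v *)
From HB Require Import structures.
From Stdlib Require Import Relation_Definitions Relation_Operators.
From mathcomp Require Import all_boot generic_quotient.
From mathcomp Require Import boolp classical_sets functions cardinality.

Set Implicit Arguments.
Unset Strict Implicit.
Unset Printing Implicit Defensive.

Local Open Scope classical_set_scope.
Local Open Scope group_scope.
Local Open Scope quotient_scope.

(** * Groups *)

Definition subgroup (G : groupType) (H : set G) : Prop := group_closed [in H].

Definition finitely_generated (G : groupType) (H : set G) : Prop :=
  exists S : set G, finite_set S /\ smallest (@subgroup G) S = H.

(* [F] is freely generated by [X], along [i], when it has the universal
   property of the free group on [X]. *)
Definition free_group_on (X : Type) (F : groupType) (i : X -> F) : Prop :=
  forall (H : groupType) (f : X -> H),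
  exists2 phi : {multiplicative F -> H}, phi \o i =1 f &
    forall psi : {multiplicative F -> H}, psi \o i =1 f -> psi =1 phi.

(** * The free monoid *)

Definition word (Y : Type) : Type := seq Y.

HB.instance Definition _ (Y : choiceType) := Choice.on (word Y).
HB.instance Definition _ (Y : choiceType) :=
  isMonoid.Build (word Y) (@catA Y) (@cat0s Y) (@cats0 Y).

(** * Rewriting systems *)

(* The alphabet [Y], always a [finType] in rewriting systems, is carried by
   the type of the set of rules. *)
Definition rules (Y : Type) : Type := set (word Y * word Y).

Section RewritingSystem.
Variables (Y : finType) (R : rules Y).

Definition rw_step : relation (word Y) := fun x y =>
  exists x1 x2 u v : word Y, [/\ R (u, v), x = x1 * u * x2 & y = x1 * v * x2].

Definition rw_steps : relation (word Y) := clos_refl_trans _ rw_step.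

Definition rw_irreducible (x : word Y) : Prop :=
  ~ exists y, y <> x /\ rw_step x y.

Definition rw_terminating : Prop :=
  ~ exists x : nat -> word Y, forall n, rw_step (x n) (x n.+1).

Definition rw_confluent : Prop :=
  forall x y z, rw_steps x y -> rw_steps x z ->
  exists2 x', rw_steps y x' & rw_steps z x'.

Definition rw_complete : Prop := rw_terminating /\ rw_confluent.

(** * The monoid presented by a rewriting system *)

(* The smallest congruence on the free monoid containing [R]: it is the
   equivalence closure of [rw_step], which is stable under contexts. *)
Definition rw_congr : relation (word Y) := clos_refl_sym_trans _ rw_step.

Definition rw_congrb (x y : word Y) : bool := `[< rw_congr x y >].

Lemma rw_congrb_refl : reflexive rw_congrb.
Proof. by move=> x; apply/asboolP; apply: rst_refl. Qed.

Lemma rw_congrb_sym : symmetric rw_congrb.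
Proof. by move=> x y; apply/asboolP/asboolP; apply: rst_sym. Qed.

Lemma rw_congrb_trans : transitive rw_congrb.
Proof.
move=> y x z /asboolP xy /asboolP yz; apply/asboolP; exact: rst_trans xy yz.
Qed.

Canonical rw_equiv :=
  EquivRel rw_congrb rw_congrb_refl rw_congrb_sym rw_congrb_trans.

Definition presented_monoid := {eq_quot rw_equiv}.

HB.instance Definition _ := EqQuotient.on presented_monoid.
HB.instance Definition _ := Choice.on presented_monoid.

Lemma rw_step_context (a b x y : word Y) :
  rw_step x y -> rw_step (a * x * b) (a * y * b).
Proof.
move=> [x1 [x2 [u [v [Ruv -> ->]]]]]; exists (a * x1), (x2 * b), u, v.
by split=> //; rewrite !mulgA.
Qed.

Lemma rw_congr_context (a b x y : word Y) :
  rw_congr x y -> rw_congr (a * x * b) (a * y * b).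
Proof.
elim=> {x y} [x y xy|x|x y _ IH|x y z _ IH1 _ IH2].
- exact/rst_step/rw_step_context.
- exact: rst_refl.
- exact: rst_sym.
- exact: rst_trans IH1 IH2.
Qed.

Definition presented_class (w : word Y) : presented_monoid :=
  \pi_presented_monoid w.

Lemma presented_classP (x y : word Y) :
  presented_class x = presented_class y <-> rw_congr x y.
Proof.
by split=> [/eqmodP/asboolP //|xy]; apply/eqmodP/asboolP.
Qed.

Lemma presented_class_repr (p : presented_monoid) : presented_class (repr p) = p.
Proof. exact: reprK. Qed.

Definition presented_mul (p q : presented_monoid) : presented_monoid :=
  presented_class (repr p * repr q).

Lemma presented_class_mul (x y : word Y) :
  presented_mul (presented_class x) (presented_class y) =
  presented_class (x * y).
Proof.
apply/presented_classP; set x' := repr _; set y' := repr _.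
have xx' : rw_congr x' x by apply/presented_classP/presented_class_repr.
have yy' : rw_congr y' y by apply/presented_classP/presented_class_repr.
apply: (rst_trans _ _ _ (x * y')).
  by have := rw_congr_context 1 y' xx'; rewrite !mul1g.
by have := rw_congr_context x 1 yy'; rewrite !mulg1.
Qed.

Lemma presented_mulA : associative presented_mul.
Proof.
move=> p q r.
rewrite -(presented_class_repr p) -(presented_class_repr q).
by rewrite -(presented_class_repr r) !presented_class_mul mulgA.
Qed.

Lemma presented_mul1 : left_id (presented_class 1) presented_mul.
Proof.
by move=> p; rewrite -(presented_class_repr p) presented_class_mul mul1g.
Qed.

Lemma presented_mulr1 : right_id (presented_class 1) presented_mul.
Proof.
by move=> p; rewrite -(presented_class_repr p) presented_class_mul mulg1.
Qed.

HB.instance Definition _ := isMonoid.Build presented_monoid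
  presented_mulA presented_mul1 presented_mulr1.

(* The isomorphism from the presented monoid to [G] is required to induce the
   given map [pi] on words. *)
Definition finite_complete_rws_for (G : groupType) (pi : word Y -> G) : Prop :=
  [/\ finite_set R, rw_complete &
      exists f : presented_monoid -> G,
        [/\ monoid_morphism f, bijective f &
            forall w, f (presented_class w) = pi w]].

End RewritingSystem.

(** * Compatibility with subgroups *)

(* The disjoint union of [Y], [Ya] and one new letter, [None]. *)
Definition ext_alphabet (Y Ya : finType) : finType := option (Y + Ya).

Section ExtendedAlphabet.
Variables Y Ya : finType.

Definition new_letter : word (ext_alphabet Y Ya) := [:: None].

Definition word_inl (w : word Y) : word (ext_alphabet Y Ya) :=
  map (fun y => Some (inl y)) w.

Definition word_inr (w : word Ya) : word (ext_alphabet Y Ya) :=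
  map (fun y => Some (inr y)) w.

Definition ext_rules (R : rules Y) (Ra : rules (ext_alphabet Y Ya)) :
    rules (ext_alphabet Y Ya) :=
  [set (word_inl r.1, word_inl r.2) | r in R] `|` Ra.

End ExtendedAlphabet.

Arguments new_letter {Y Ya}.
Arguments word_inl {Y Ya}.
Arguments word_inr {Y Ya}.

Section Compatibility.
Variables (Y : finType) (R : rules Y) (G : groupType) (pi : word Y -> G).
Variables (A : Type) (Ga : A -> set G).
Local Notation t := new_letter.

Definition left_compatible : Prop :=
  forall a : A, exists (Ya : finType) (pia : word Ya -> G)
    (Ra : rules (ext_alphabet Y Ya)),
  [/\ monoid_morphism pia /\ range pia = Ga a,
      finite_set Ra,
      rw_terminating (ext_rules R Ra),
      forall r, Ra r -> exists (u w : word Y) (v : word Ya),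
        r = (t * word_inl u, word_inr v * t * word_inl w) /\
        pi u = pia v * pi w &
      forall u v : word Y,
        rw_irreducible (ext_rules R Ra) (t * word_inl u) ->
        rw_irreducible (ext_rules R Ra) (t * word_inl v) ->
        u = v <-> [set h * pi u | h in Ga a] = [set h * pi v | h in Ga a]].

Definition right_compatible : Prop :=
  forall a : A, exists (Ya : finType) (pia : word Ya -> G)
    (Ra : rules (ext_alphabet Y Ya)),
  [/\ monoid_morphism pia /\ range pia = Ga a,
      finite_set Ra,
      rw_terminating (ext_rules R Ra),
      forall r, Ra r -> exists (u w : word Y) (v : word Ya),
        r = (word_inl u * t, word_inl w * t * word_inr v) /\
        pi u = pi w * pia v &
      forall u v : word Y,
        rw_irreducible (ext_rules R Ra) (word_inl u * t) ->
        rw_irreducible (ext_rules R Ra) (word_inl v * t) ->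
        u = v <-> [set pi u * h | h in Ga a] = [set pi v * h | h in Ga a]].

End Compatibility.

(** * The standard rewriting system of a free group *)

(* [(x, true)] is the letter x and [(x, false)] the letter x^-1. *)
Definition signed_letter (X : finType) : finType := (X * bool)%type.

Definition free_rules (X : finType) : rules (signed_letter X) :=
  [set ([:: (x, true); (x, false)], [::]) | x in [set: X]] `|`
  [set ([:: (x, false); (x, true)], [::]) | x in [set: X]].

Definition free_eval (X : finType) (F : groupType) (i : X -> F)
    (w : word (signed_letter X)) : F :=
  \prod_(l <- w) (if l.2 then i l.1 else (i l.1)^-1).

(* Main.v *)
(* Let H be a finitely generated subgroup of F. In the Schreier graph of H\F,
   choose a finite tree T of reduced words rooted at the coset H and meeting
   every coset visited by the paths of the generators of H; then the path of any
   reduced word of H only visits cosets of T. The rules are t p y -> v t w for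
   p, w in T and p y not in T with H p y = H w. They terminate because each rule,
   the free cancellations included, decreases the number of letters read outside
   the tree. If u and u' are irreducible after t, with H u = H u', cancel their
   common suffix; then u u'^-1 is a reduced word of H, so the paths of u and u'
   stay in T, irreducibility forces u and u' to belong to T, and they are equal.
   The right-handed system is the image of the left-handed one under word
   inversion. *)
From HB Require Import structures.
From Stdlib Require Import Relation_Operators.
Require Import Defs.
From mathcomp Require Import all_boot generic_quotient.
From mathcomp Require Import boolp classical_sets functions cardinality.

Set Implicit Arguments.
Unset Strict Implicit.
Unset Printing Implicit Defensive.

Local Open Scope classical_set_scope.
Local Open Scope group_scope.

(** * Reduced words, free reduction and confluence *)

Section SignedWords.
Variable X : finType.
Local Notation Y := (signed_letter X).
Implicit Types (a b : Y) (u v w : word Y).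

Definition flip a : Y := (a.1, ~~ a.2).

Lemma flipK : involutive flip.
Proof. by case=> x e; rewrite /flip /= negbK. Qed.

Definition word_inv w : word Y := rev (map flip w).

Lemma word_invK : involutive word_inv.
Proof. by move=> w; rewrite /word_inv map_rev revK mapK //; exact: flipK. Qed.

Lemma word_inv_cons a w : word_inv (a :: w) = rcons (word_inv w) (flip a).
Proof. by rewrite /word_inv /= rev_cons. Qed.

Lemma word_inv_rcons w a : word_inv (rcons w a) = flip a :: word_inv w.
Proof. by rewrite /word_inv map_rcons rev_rcons. Qed.

Definition reduced w : bool := sorted (fun a b => b != flip a) w.

Lemma reduced_catl u v : reduced (u ++ v) -> reduced u.
Proof. by case: u => //= a u; rewrite cat_path => /andP[]. Qed.

Lemma reducedPn w : ~~ reduced w ->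
  exists x1 x2 a, w = x1 ++ a :: flip a :: x2.
Proof.
elim: w => [//|a [//|b w] IH]; rewrite /reduced /= negb_and negbK.
move=> /orP[/eqP->|/IH[x1 [x2 [c ->]]]]; first by exists [::], w, a.
by exists (a :: x1), x2, c.
Qed.

Lemma reduced_inv w : reduced (word_inv w) = reduced w.
Proof.
rewrite /reduced /word_inv rev_sorted sorted_map; case: w => //= a w; apply: eq_path => {a}a b /=.
by rewrite flipK eq_sym.
Qed.

(** Cancellation could occur only at the junction, between the last letter of [u] and the inverse of
    the last letter of [v]; these last letters differ. *)
Lemma reduced_cat_inv u v : reduced u -> reduced v ->
  (forall u' v' a, u = rcons u' a -> v <> rcons v' a) ->
  reduced (u ++ word_inv v).
Proof.
case/lastP: u => [|u a] ru rv uv; first by rewrite /= reduced_inv.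
case/lastP: v rv uv => [|v b] rv uv; first by rewrite cats0.
rewrite -reduced_inv word_inv_rcons /reduced /= in rv.
rewrite word_inv_rcons cat_rcons /reduced.
case: u ru uv => [|c u] ru uv.
  rewrite /= (inj_eq (can_inj flipK)) rv andbT.
  by apply/eqP => ba; apply: (uv [::] v a); rewrite ?ba.
rewrite /reduced /= in ru; rewrite /= -cat_rcons cat_path ru last_rcons /=.
rewrite (inj_eq (can_inj flipK)) rv andbT.
by apply/eqP => ba; apply: (uv (c :: u) v a); rewrite ?ba.
Qed.

Lemma free_rulesP u v :
  free_rules (u, v) <-> exists a, u = [:: a; flip a] /\ v = [::].
Proof.
split=> [[] [x _] [<- <-]|[[x []]] [-> ->]].
- by exists (x, true).
- by exists (x, false).
- by left; exists x.
- by right; exists x.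
Qed.

Lemma rw_step_freeP u v : rw_step (@free_rules X) u v <->
  exists x1 x2 a, u = x1 ++ a :: flip a :: x2 /\ v = x1 ++ x2.
Proof.
split=> [[x1 [x2 [r [s [/free_rulesP[a [-> ->]] -> ->]]]]]|[x1 [x2 [a [-> ->]]]]].
  by exists x1, x2, a; rewrite /mul /= -catA cats0.
exists x1, x2, [:: a; flip a], [::]; rewrite /mul /= -catA cats0.
by split=> //; apply/free_rulesP; exists a.
Qed.

(** Left multiplication by a letter on normal forms. Making words act on reduced words, as in van
    der Waerden's argument, yields the normal form by a single fold. *)
Definition push a w : word Y :=
  if w is b :: w' then if b == flip a then w' else a :: w else [:: a].

Definition free_reduction w : word Y := foldr push [::] w.

Lemma reduced_push a w : reduced w -> reduced (push a w).
Proof.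
case: w => //= b w rw; case: eqP => [_|/eqP ba]; first exact: path_sorted rw.
by rewrite /reduced /= ba.
Qed.

Lemma push_reduced a w : reduced (a :: w) -> push a w = a :: w.
Proof. by case: w => //= b w /andP[/negbTE->]. Qed.

(** The delicate case is [w] beginning with [a]: being reduced, its tail does not begin with
    [flip a], so pushing [a] puts the letter back. *)
Lemma pushK a w : reduced w -> push a (push (flip a) w) = w.
Proof.
case: w => [|b w] rw /=; first by rewrite eqxx.
rewrite flipK; case: eqP => [ba|_] /=; last by rewrite eqxx.
by rewrite -ba push_reduced.
Qed.

Lemma reduced_free_reduction w : reduced (free_reduction w).
Proof. by elim: w => //= a w; apply: reduced_push. Qed.

Lemma free_reduction_id w : reduced w -> free_reduction w = w.
Proof.
by elim: w => //= a w IH rw; rewrite IH ?push_reduced //; apply: path_sorted rw.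
Qed.

Lemma free_reduction_step u v :
  rw_step (@free_rules X) u v -> free_reduction u = free_reduction v.
Proof.
move=> /rw_step_freeP[x1 [x2 [a [-> ->]]]].
by rewrite /free_reduction !foldr_cat /= pushK // reduced_free_reduction.
Qed.

Lemma free_reduction_congr u v :
  rw_congr (@free_rules X) u v -> free_reduction u = free_reduction v.
Proof.
by elim=> {u v} [u v /free_reduction_step|||u v w _ -> _ ->].
Qed.

Lemma rw_steps_cons a u v : rw_steps (@free_rules X) u v ->
  rw_steps (@free_rules X) (a :: u) (a :: v).
Proof.
elim=> {u v} [u v uv|u|u v w _ IH1 _ IH2]; last exact: rt_trans IH1 IH2.
  apply: rt_step; have := rw_step_context [:: a] [::] uv.
  by rewrite /mul /= !cats0.
exact: rt_refl.
Qed.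

Lemma rw_steps_free_reduction w :
  rw_steps (@free_rules X) w (free_reduction w).
Proof.
elim: w => [|a w IH] /=; first exact: rt_refl.
apply: rt_trans (rw_steps_cons a IH) _.
case: (free_reduction w) => [|b v] /=; first exact: rt_refl.
case: eqP => [->|_]; last exact: rt_refl.
by apply/rt_step/rw_step_freeP; exists [::], v, a.
Qed.

(** Free reduction is invariant under steps and reachable from every word, so it is a common
    descendant. *)
Lemma free_rules_confluent : rw_confluent (@free_rules X).
Proof.
have steps x y : rw_steps (@free_rules X) x y ->
    free_reduction x = free_reduction y.
  by elim=> {x y} [x y /free_reduction_step||x y z _ -> _ ->].
move=> x y z /steps xy /steps xz; exists (free_reduction x).
  by rewrite xy; apply: rw_steps_free_reduction.
by rewrite xz; apply: rw_steps_free_reduction.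
Qed.

Lemma rw_congr_mul_inv w : rw_congr (@free_rules X) (w ++ word_inv w) [::].
Proof.
elim: w => [|a w IH]; first exact: rst_refl.
rewrite word_inv_cons -rcons_cat /=.
apply: rst_trans (_ : rw_congr _ [:: a; flip a] _).
  by have := rw_congr_context [:: a] [:: flip a] IH; rewrite /mul /= cats1.
by apply/rst_step/rw_step_freeP; exists [::], [::], a.
Qed.

End SignedWords.

(** * Termination and finiteness of the free cancellations *)

Lemma rw_terminating_measure (Y : finType) (R : rules Y) (m : word Y -> nat) :
  (forall x y, rw_step R x y -> m y < m x) -> rw_terminating R.
Proof.
move=> dec [x xS].
have bound n : m (x n) + n <= m (x 0).
  elim: n => [|n]; first by rewrite addn0.
  by apply: leq_trans; rewrite addnS -addSn leq_add2r dec.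
by have := bound (m (x 0)).+1; rewrite addnS ltnNge leq_addl.
Qed.

Lemma free_rules_terminating (X : finType) : rw_terminating (@free_rules X).
Proof.
apply: (@rw_terminating_measure _ _ size) => x y.
by move=> /rw_step_freeP[x1 [x2 [a [-> ->]]]]; rewrite !size_cat !addnS ltnS leqW.
Qed.

Lemma finite_free_rules (X : finType) : finite_set (@free_rules X).
Proof. by rewrite /free_rules finite_setU; split; apply: finite_image. Qed.

(** * The group structure on the presented monoid *)

Section PresentedFreeGroup.
Variable X : finType.
Local Notation PF := (presented_monoid (@free_rules X)).

Definition presented_inv (p : PF) : PF := presented_class _ (word_inv (repr p)).

HB.instance Definition _ := hasInv.Build PF presented_inv.

Lemma presented_mulgV : right_inverse 1 presented_inv (@mul PF).
Proof.
move=> p; rewrite -{1}(presented_class_repr p) /presented_inv.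
rewrite [LHS]presented_class_mul; apply/presented_classP.
exact: rw_congr_mul_inv.
Qed.

Lemma presented_mulVg : left_inverse 1 presented_inv (@mul PF).
Proof.
move=> p; rewrite -{2}(presented_class_repr p) /presented_inv.
rewrite [LHS]presented_class_mul; apply/presented_classP.
by have := rw_congr_mul_inv (word_inv (repr p)); rewrite word_invK.
Qed.

HB.instance Definition _ :=
  Monoid_isGroup.Build PF presented_mulVg presented_mulgV.

Lemma presented_classM (u v : word (signed_letter X)) :
  presented_class (@free_rules X) (u ++ v) =
  (presented_class _ u : PF) * presented_class _ v.
Proof. by rewrite [RHS]presented_class_mul. Qed.

Lemma presented_classV (u : word (signed_letter X)) :
  presented_class (@free_rules X) (word_inv u) = (presented_class _ u : PF)^-1.
Proof.
apply/esym/mulg1_eq; rewrite -presented_classM.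
by apply/presented_classP/rw_congr_mul_inv.
Qed.

End PresentedFreeGroup.

(** * Evaluation of signed words in a group *)

Section FreeEval.
Variables (X : finType) (F : groupType) (i : X -> F).
Local Notation ev := (free_eval i).
Implicit Types (u v w : word (signed_letter X)).

Lemma free_eval_nil : ev [::] = 1.
Proof. by rewrite /free_eval big_nil. Qed.

Lemma free_eval_cons a w :
  ev (a :: w) = (if a.2 then i a.1 else (i a.1)^-1) * ev w.
Proof. by rewrite /free_eval big_cons. Qed.

Lemma free_eval_cat u v : ev (u ++ v) = ev u * ev v.
Proof. by rewrite /free_eval big_cat. Qed.

Lemma free_eval_rcons u a : ev (rcons u a) = ev u * ev [:: a].
Proof. by rewrite -cats1 free_eval_cat. Qed.

Lemma free_eval_flip a : ev [:: flip a] = (ev [:: a])^-1.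
Proof.
by case: a => x [] //=; rewrite !free_eval_cons free_eval_nil !mulg1 //= invgK.
Qed.

Lemma free_eval_inv w : ev (word_inv w) = (ev w)^-1.
Proof.
elim: w => [|a w IH]; first by rewrite free_eval_nil invg1.
rewrite word_inv_cons -cat1s free_eval_cat invgM -IH -free_eval_flip.
by rewrite -free_eval_cat cats1.
Qed.

Lemma free_eval_monoid_morphism : monoid_morphism ev.
Proof. by split; [apply: free_eval_nil | apply: free_eval_cat]. Qed.

Lemma free_eval_congr u v : rw_congr (@free_rules X) u v -> ev u = ev v.
Proof.
elim=> {u v} [u v /rw_step_freeP[x1 [x2 [a [-> ->]]]]|||u v w _ -> _ ->] //.
rewrite free_eval_cat -cat1s free_eval_cat -[flip a :: x2]cat1s free_eval_cat.
by rewrite free_eval_flip mulVKg -free_eval_cat.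
Qed.

End FreeEval.

(** * The presented group is the free group *)

Section FreeGroup.
Variables (X : finType) (F : groupType) (i : X -> F) (freeF : free_group_on i).
Local Notation ev := (free_eval i).
Local Notation PF := (presented_monoid (@free_rules X)).

Definition presented_eval (p : PF) : F := ev (repr p).

Lemma presented_eval_class w :
  presented_eval (presented_class (@free_rules X) w) = ev w.
Proof. by apply/free_eval_congr/presented_classP/presented_class_repr. Qed.

Lemma presented_evalM : {morph presented_eval : x y / x * y}.
Proof. by move=> p q; rewrite [LHS]presented_eval_class [LHS]free_eval_cat. Qed.

HB.instance Definition _ := isMultiplicative.Build PF F presented_eval presented_evalM.

(* The universal property provides a map back to the presented group; it is a
   two-sided inverse because both composites fix the generators. *)
Lemma presented_eval_bijective : bijective presented_eval.
Proof.
have [phi phi_i _] := freeF (fun x => presented_class _ [:: (x, true)] : PF).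
have [idF _ idF_uniq] := freeF i.
(* Only multiplicativity of [phi] is given; units and inverses follow by cancellation in the target
   group. *)
have phi1 : phi 1 = 1 by apply: (mulgI (phi 1)); rewrite -gmulfM !mulg1.
have phiV g : phi g^-1 = (phi g)^-1.
  by apply/esym/mulg1_eq; rewrite -gmulfM mulgV.
exists phi => [p|g].
  rewrite -(presented_class_repr p) presented_eval_class; elim: (repr p) => [|a w IH].
    by rewrite free_eval_nil.
  rewrite -cat1s free_eval_cat gmulfM IH presented_classM; congr (_ * _).
  case: a => x []; rewrite free_eval_cons free_eval_nil mulg1 /= ?phiV.
    exact: phi_i.
  by have /= -> := phi_i x; rewrite -presented_classV.
have id1 : presented_eval \o phi =1 idF.
  apply: idF_uniq => x /=; have /= -> := phi_i x.
  by rewrite presented_eval_class free_eval_cons free_eval_nil mulg1.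
have id2 : idfun =1 idF by apply: idF_uniq.
by have /= -> := id1 g; rewrite -id2.
Qed.

Lemma free_eval_eqP u v : ev u = ev v <-> rw_congr (@free_rules X) u v.
Proof.
split=> [uv|]; last exact: free_eval_congr.
by apply/presented_classP/(bij_inj presented_eval_bijective);
  rewrite !presented_eval_class.
Qed.

Lemma free_eval_surj g : exists w, ev w = g.
Proof.
by have [f _ fK] := presented_eval_bijective; exists (repr (f g)); apply: fK.
Qed.

Lemma free_complete_rws : finite_complete_rws_for (@free_rules X) ev.
Proof.
split; first exact: finite_free_rules.
  by split; [apply: free_rules_terminating | apply: free_rules_confluent].
exists presented_eval; split.
- by split; [rewrite [LHS]presented_eval_class free_eval_nil | apply: presented_evalM].
- exact: presented_eval_bijective.
- exact: presented_eval_class.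
Qed.

End FreeGroup.

(** * A termination measure relative to a tree of words *)

Section TreeCost.
Variables (X Z : finType).
Local Notation Y := (signed_letter X).
Local Notation E := (ext_alphabet Y (signed_letter Z)).
Variable T : seq (word Y).

(* Counts the letters of [Y] at which a word does not follow the tree [T];
   following [T] starts afresh after each new letter, and the state is the node
   reached in [T], if any. *)
Fixpoint tree_cost (s : option (word Y)) (w : word E) : nat :=
  match w with
  | [::] => 0
  | None :: w' => tree_cost (Some [::]) w'
  | Some (inr _) :: w' => tree_cost None w'
  | Some (inl y) :: w' =>
      if s is Some p then
        if rcons p y \in T then tree_cost (Some (rcons p y)) w'
        else (tree_cost None w').+1
      else (tree_cost None w').+1
  end.

(** Off the tree, every letter of [Y] before the next new letter is charged, so this state is the
    most expensive. *)
Lemma tree_cost_le s w : tree_cost s w <= tree_cost None w.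
Proof.
elim: w s => [|[[y|z]|] w IH] s //=; case: s => [p|] //.
by case: ifP => // _; apply: leqW.
Qed.

(** The state in which [x] leaves the reader is arbitrary, so the comparison is required in all
    states at once. *)
Lemma tree_cost_context x u v :
  (forall s, tree_cost s v < tree_cost s u) ->
  forall s, tree_cost s (x ++ v) < tree_cost s (x ++ u).
Proof.
move=> uv; elim: x => [|[[y|z]|] x IH] s //=.
by case: s => [p|]; [case: ifP => _|]; rewrite ?ltnS //; apply: IH.
Qed.

Hypothesis T_prefix : forall p y, rcons p y \in T -> p \in T.
Hypothesis T_reduced : forall p, p \in T -> reduced p.

(** Words of [T] are reduced, so the two letters cannot both follow the tree: at least one is
    charged. The state is then off the tree, where reading [w] costs at least as much as from
    [s]. *)
Lemma tree_cost_cancel s y w :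
  tree_cost s w < tree_cost s (Some (inl y) :: Some (inl (flip y)) :: w).
Proof.
case: s => [p|] /=; last by apply: leqW.
have cost_le := tree_cost_le (Some p) w.
case: ifP => _; last by rewrite ltnS leqW.
case: ifP => [/T_reduced|_]; last by rewrite ltnS.
rewrite /reduced -cats1 -cats1 -catA /= => /cat_sorted2[_ /=].
by rewrite eqxx.
Qed.

Lemma tree_cost_tree p w : p \in T ->
  tree_cost (Some [::]) (word_inl p ++ w) = tree_cost (Some p) w.
Proof.
elim/last_ind: p w => [//|p y IH] w Tpy.
by rewrite /word_inl map_rcons cat_rcons IH ?(T_prefix Tpy) //= Tpy.
Qed.

Lemma tree_cost_inr s v w :
  tree_cost s (word_inr v ++ None :: w) = tree_cost (Some [::]) w.
Proof. by elim: v s => //= z v IH s; rewrite IH. Qed.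

(** On the left of a rule in [Ra], [p] is free but [y] leaves the tree and is charged. On the right,
    [v] and [w] are free and the reader is still on the tree. *)
Lemma tree_cost_decreasing (Ra : rules E) :
  (forall r, Ra r -> exists p y w v, [/\ p \in T, rcons p y \notin T, w \in T &
     r = (new_letter * word_inl (rcons p y),
          word_inr v * new_letter * word_inl w)]) ->
  forall x y, rw_step (ext_rules (@free_rules X) Ra) x y ->
    tree_cost None y < tree_cost None x.
Proof.
move=> RaT x y [x1 [x2 [u [v [Ruv -> ->]]]]].
rewrite /mul /= -!catA; apply: tree_cost_context => s {x1}.
case: Ruv => [[[u1 v1] /free_rulesP[a [/= -> ->]] [<- <-]]|].
  exact: tree_cost_cancel.
move=> /RaT[p [a [w [z [Tp Tpa Tw [-> ->]]]]]].
rewrite /mul /= -!catA tree_cost_inr tree_cost_tree //.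
rewrite /word_inl map_rcons cat_rcons tree_cost_tree //= (negbTE Tpa) ltnS.
exact: tree_cost_le.
Qed.

End TreeCost.

(** * Exchanging left and right by word inversion *)

Section Mirror.
Variables X Z : finType.
Local Notation Y := (signed_letter X).
Local Notation Ya := (signed_letter Z).
Local Notation E := (ext_alphabet Y Ya).

Definition ext_flip (e : E) : E :=
  match e with
  | Some (inl y) => Some (inl (flip y))
  | Some (inr z) => Some (inr (flip z))
  | None => None
  end.

(** An anti-automorphism of the extended free monoid that fixes the new letter, and so carries [t u]
    to [u^-1 t]. *)
Definition ext_inv (w : word E) : word E := rev (map ext_flip w).

Lemma ext_invK : involutive ext_inv.
Proof.
move=> w; rewrite /ext_inv map_rev revK mapK // => -[[y|z]|] //=;
by rewrite flipK.
Qed.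

Lemma ext_inv_cat u v : ext_inv (u ++ v) = ext_inv v ++ ext_inv u.
Proof. by rewrite /ext_inv map_cat rev_cat. Qed.

Lemma ext_inv_inl u : ext_inv (word_inl u) = word_inl (word_inv u).
Proof. by rewrite /ext_inv /word_inl map_rev -!map_comp. Qed.

Lemma ext_inv_inr v : ext_inv (word_inr v) = word_inr (word_inv v).
Proof. by rewrite /ext_inv /word_inr map_rev -!map_comp. Qed.

Definition mirror_rules (Ra : rules E) : rules E :=
  [set (ext_inv r.1, ext_inv r.2) | r in Ra].

(** Inversion permutes the free cancellations, so only [Ra] has to be replaced by its mirror
    image. *)
Lemma rw_step_mirror (Ra : rules E) x y :
  rw_step (ext_rules (@free_rules X) (mirror_rules Ra)) x y <->
  rw_step (ext_rules (@free_rules X) Ra) (ext_inv x) (ext_inv y).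
Proof.
have step (R1 R2 : rules E) x' y' :
    (forall u v, R1 (u, v) -> R2 (ext_inv u, ext_inv v)) ->
    rw_step (ext_rules (@free_rules X) R1) x' y' ->
    rw_step (ext_rules (@free_rules X) R2) (ext_inv x') (ext_inv y').
  move=> R12 [x1 [x2 [u [v [Ruv -> ->]]]]].
  exists (ext_inv x2), (ext_inv x1), (ext_inv u), (ext_inv v).
  split; last 2 first.
  - by rewrite /mul /= !ext_inv_cat catA.
  - by rewrite /mul /= !ext_inv_cat catA.
  case: Ruv => [[[u1 v1] /free_rulesP[a [/= -> ->]] [<- <-]]|/R12]; last by right.
  left; exists ([:: a; flip a], [::]); first by apply/free_rulesP; exists a.
  by rewrite /ext_inv /= flipK.
split; first by apply: step => u v [[u1 v1] Ra1 [<- <-]]; rewrite !ext_invK.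
rewrite -{2}(ext_invK x) -{2}(ext_invK y).
by apply: step => u v Ruv; exists (u, v).
Qed.

Lemma rw_terminating_mirror (Ra : rules E) :
  rw_terminating (ext_rules (@free_rules X) Ra) ->
  rw_terminating (ext_rules (@free_rules X) (mirror_rules Ra)).
Proof.
move=> Rt [x xS]; apply: Rt; exists (ext_inv \o x) => n.
exact/rw_step_mirror.
Qed.

Lemma rw_irreducible_mirror (Ra : rules E) x :
  rw_irreducible (ext_rules (@free_rules X) (mirror_rules Ra)) x ->
  rw_irreducible (ext_rules (@free_rules X) Ra) (ext_inv x).
Proof.
move=> irr [y [yx xy]]; apply: irr; exists (ext_inv y); split.
  by move=> eyx; apply: yx; rewrite -eyx ext_invK.
by apply/rw_step_mirror; rewrite ext_invK.
Qed.

End Mirror.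

(** * Subgroups and equality of cosets *)

Section Subgroup.
Variables (G : groupType) (H : set G).

Lemma subgroupP : subgroup H <-> H 1 /\ forall g h, H g -> H h -> H (g / h).
Proof.
split=> [[H1 HF]|[H1 HF]].
  split=> [|g h Hg Hh]; first by move: H1; rewrite !inE.
  by have := HF g h; rewrite !inE; apply.
by split=> [|g h]; rewrite !inE //; apply: HF.
Qed.

Hypothesis sH : subgroup H.

Lemma subgroup1 : H 1. Proof. by have [] := subgroupP.1 sH. Qed.

Lemma subgroupF g h : H g -> H h -> H (g / h).
Proof. by have [_ +] := subgroupP.1 sH; apply. Qed.

Lemma subgroupV g : H g -> H g^-1.
Proof. by move=> Hg; rewrite -div1g; apply: subgroupF => //; apply: subgroup1. Qed.

Lemma subgroupM g h : H g -> H h -> H (g * h).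
Proof. by move=> Hg /subgroupV Hh; rewrite -(invgK h); apply: subgroupF. Qed.

Lemma right_coset_eqP g h :
  [set k * g | k in H] = [set k * h | k in H] <-> H (g / h).
Proof.
split=> [gh|Hgh].
  have : [set k * h | k in H] g.
    by rewrite -gh; exists 1; rewrite ?mul1g //; apply: subgroup1.
  by move=> [k Hk <-]; rewrite mulgK.
apply/seteqP; split=> _ [k Hk <-].
  by exists (k * (g / h)); [apply: subgroupM | rewrite mulgA mulgVK].
exists (k * (g / h)^-1); last by rewrite invgF mulgA mulgVK.
exact: subgroupF.
Qed.

(** Inversion turns [g H] into [H g^-1], which brings the question back to right cosets. *)
Lemma left_coset_eqP g h :
  [set g * k | k in H] = [set h * k | k in H] <-> H (g^-1 / h^-1).
Proof.
have invH x : [set x * k | k in H] = (fun y => y^-1) @` [set k * x^-1 | k in H].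
  apply/seteqP; split=> [_ [k Hk <-]|_ [_ [k Hk <-] <-]].
    exists (k^-1 * x^-1); last by rewrite invgF invgK.
    by exists k^-1 => //; apply: subgroupV.
  by exists k^-1; [apply: subgroupV | rewrite invgF].
split=> [gh|/right_coset_eqP gh]; last by rewrite !invH gh.
have [k Hk <-] : [set h * k | k in H] g.
  by rewrite -gh; exists 1; [apply: subgroup1 | rewrite mulg1].
by rewrite invgM invgK mulgVK; apply: subgroupV.
Qed.

End Subgroup.

(** * Paths in the Cayley graph *)

Section PathIn.
Variables (X : finType) (F : groupType) (i : X -> F).
Local Notation Y := (signed_letter X).
Local Notation ev := (free_eval i).
Implicit Types (P Q : F -> Prop) (u v w : word Y).

(** All vertices of the path labelled [w] from [g] in the Cayley graph, both ends included, satisfy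
    [P]. When [P] is invariant under left multiplication by [H], this describes a path in the
    Schreier graph. *)
Fixpoint path_in P g w : Prop :=
  if w is a :: w' then P g /\ path_in P (g * ev [:: a]) w' else P g.

Lemma path_in_start P g w : path_in P g w -> P g.
Proof. by case: w => [|a w] // []. Qed.

Lemma path_in_cat P g u v :
  path_in P g (u ++ v) <-> path_in P g u /\ path_in P (g * ev u) v.
Proof.
elim: u g => [|a u IH] g /=.
  by rewrite free_eval_nil mulg1; split=> [Pv|[]//]; split=> //; exact: path_in_start Pv.
rewrite IH -[a :: u]cat1s free_eval_cat mulgA; tauto.
Qed.

Lemma path_in_end P g w : path_in P g w -> P (g * ev w).
Proof. by rewrite -{1}(cats0 w) path_in_cat => -[]. Qed.

(** Serves both to enlarge the set of allowed vertices and to translate a path to another starting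
    point. *)
Lemma path_in_impl P Q g h w :
  (forall x, P (g * x) -> Q (h * x)) -> path_in P g w -> path_in Q h w.
Proof.
elim: w g h => [|a w IH] g h PQ /=.
  by move=> Pg; rewrite -(mulg1 h); apply: PQ; rewrite mulg1.
move=> [Pg Pw]; split; first by rewrite -(mulg1 h); apply: PQ; rewrite mulg1.
by apply: IH Pw => x; rewrite -!mulgA; apply: PQ.
Qed.

Lemma path_in_inv P g w : path_in P g w -> path_in P (g * ev w) (word_inv w).
Proof.
elim: w g => [|a w IH] g; first by rewrite free_eval_nil mulg1.
rewrite -[a :: w]cat1s free_eval_cat mulgA => /= -[Pg Pw].
rewrite word_inv_cons -cats1 path_in_cat; split; first exact: IH.
rewrite free_eval_inv mulgK /= free_eval_flip mulgK; split=> //.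
exact: path_in_start Pw.
Qed.

(** A cancellation removes a backtrack, so the shorter path visits no new vertex. *)
Lemma path_in_steps P g u v :
  rw_steps (@free_rules X) u v -> path_in P g u -> path_in P g v.
Proof.
elim=> {u v} [u v /rw_step_freeP[x1 [x2 [a [-> ->]]]]|//|u v w _ IH1 _ IH2].
  rewrite -[a :: _]/([:: a; flip a] ++ x2) !path_in_cat => -[Px1 [_]].
  rewrite -[[:: a; _]]/([:: a] ++ [:: flip a]) free_eval_cat free_eval_flip.
  by rewrite mulgV mulg1.
by move=> /IH1/IH2.
Qed.

End PathIn.

(** * Finite trees in the Schreier graph and normal words *)

Section SchreierTree.
Variables (X : finType) (F : groupType) (i : X -> F) (freeF : free_group_on i).
Variables (H : set F) (sH : subgroup H).
Local Notation Y := (signed_letter X).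
Local Notation ev := (free_eval i).
Implicit Types (T : seq (word Y)) (p q u v w : word Y).

(** A partial Schreier transversal: prefix closure makes it a tree rooted at the coset [H], and each
    coset has at most one representative in it. *)
Definition schreier_tree T : Prop :=
  [/\ [::] \in T, forall p y, rcons p y \in T -> p \in T &
      forall p q, p \in T -> q \in T -> H (ev p / ev q) -> p = q].

Definition on_tree T (g : F) : Prop := exists2 p, p \in T & H (g / ev p).

Lemma on_tree_mull T h g : H h -> on_tree T g -> on_tree T (h * g).
Proof.
by move=> Hh [p Tp Hg]; exists p; rewrite // -mulgA; apply: subgroupM.
Qed.

(** A backtrack [p a a^-1] in the tree would represent the same coset as its prefix [p]. *)
Lemma schreier_tree_reduced T p : schreier_tree T -> p \in T -> reduced p.
Proof.
move=> [_ Tprefix Tinj]; elim/last_ind: p => [//|p b IH] Tpb.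
have := IH (Tprefix _ _ Tpb); case/lastP: p IH Tpb => [//|p a] _ Tpab rpa.
have Tp : p \in T by apply/(Tprefix _ a)/(Tprefix _ b).
have ba : b != flip a.
  apply/eqP => ba; have := Tinj _ _ Tpab Tp; rewrite ba.
  rewrite free_eval_rcons free_eval_rcons free_eval_flip mulgK mulgV.
  move=> /(_ (subgroup1 sH)) /(congr1 size); rewrite !size_rcons.
  by move=> /eqP; rewrite -addn2 -{2}[size p]addn0 eqn_add2l.
move: rpa; case: p {Tpab Tp} => [|c p]; rewrite /reduced /=; first by rewrite ba.
by rewrite [in X in _ -> X]rcons_path last_rcons ba => ->.
Qed.

(** The path is followed letter by letter. When it leaves the tree from the coset of a node [p] by a
    letter [y], the leaf [p y] is added. *)
Lemma schreier_tree_extend T w : schreier_tree T ->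
  exists T', [/\ schreier_tree T', {subset T <= T'} &
                 path_in i (on_tree T') 1 w].
Proof.
move=> treeT; elim/last_ind: w => [|w y [T' [treeT' TT' T'w]]].
  have [T0 _ _] := treeT; exists T; split=> //=; exists [::] => //.
  by rewrite free_eval_nil divg1; apply: subgroup1.
have [p Tp Hwp] := path_in_end T'w; rewrite mul1g in Hwp.
have Hwpy : H (ev (rcons w y) / ev (rcons p y)).
  by rewrite 2!free_eval_rcons mulgKA.
case: (pselect (on_tree T' (ev (rcons w y)))) => [Twy|NTwy].
  exists T'; split=> //; rewrite -cats1 path_in_cat mul1g; split=> //=.
  rewrite -free_eval_rcons; split=> //.
  by exists p.
have [T0 Tprefix Tinj] := treeT'.
have NHpy q : q \in T' -> ~ H (ev (rcons p y) / ev q).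
  move=> Tq Hpq; apply: NTwy; exists q => //.
  by rewrite -(divgKA (ev (rcons p y))); apply: subgroupM.
have sub : {subset T' <= rcons p y :: T'}.
  by move=> q; rewrite inE => ->; rewrite orbT.
exists (rcons p y :: T'); split; last 2 first.
- by move=> q /TT'; apply: sub.
- have on_sub g : on_tree T' g -> on_tree (rcons p y :: T') g.
    by move=> [q /sub Tq Hq]; exists q.
  rewrite -(cats1 w) path_in_cat mul1g; split=> /=.
    by apply: path_in_impl T'w => x; apply: on_sub.
  rewrite -free_eval_rcons; split; first by apply: on_sub; exists p.
  by exists (rcons p y); rewrite // mem_head.
split; first exact: sub.
  move=> q z; rewrite inE => /orP[/eqP /rcons_inj[-> _]|/Tprefix]; exact: sub.
move=> q r; rewrite !inE => /orP[/eqP->|Tq] /orP[/eqP->|Tr] // Hqr.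
- by case: (NHpy r).
- by case: (NHpy q Tq); rewrite -invgF; apply: subgroupV.
- exact: Tinj.
Qed.

Lemma schreier_tree_cover (ws : seq (word Y)) :
  exists2 T, schreier_tree T &
    forall w, w \in ws -> path_in i (on_tree T) 1 w.
Proof.
elim: ws => [|w ws [T treeT Tws]].
  exists [:: [::]] => //; split; first exact: mem_head.
    by case=> [|a p] y; rewrite inE.
  by move=> p q; rewrite !inE => /eqP-> /eqP->.
have [T' [treeT' TT' T'w]] := schreier_tree_extend w treeT.
exists T' => // v; rewrite inE => /orP[/eqP->//|/Tws].
by apply: path_in_impl => x [p /TT' Tp Hp]; exists p.
Qed.

(** The elements of [H] having some word whose path stays on [T] form a subgroup [K]. A tree
    covering the generators makes [K] all of [H], and free reduction passes from some word to the
    reduced one. *)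
Lemma schreier_tree_core : finitely_generated H ->
  exists2 T, schreier_tree T &
    forall u, reduced u -> H (ev u) -> path_in i (on_tree T) 1 u.
Proof.
move=> [S [/finite_seqP[s Ss] SH]].
have [f fK] := choice (free_eval_surj freeF).
have [T treeT Tws] := schreier_tree_cover (map f s); exists T => // u ru Hu.
pose K := [set h | H h /\ exists2 w, ev w = h & path_in i (on_tree T) 1 w].
have T1 : on_tree T 1.
  exists [::]; first by case: treeT.
  by rewrite free_eval_nil divg1; apply: subgroup1.
have SK : S `<=` K.
  move=> g Sg; split; first by rewrite -SH; apply: sub_gen_smallest.
  by exists (f g) => //; apply: Tws; apply: map_f; move: Sg; rewrite Ss.
have sK : subgroup K.
  apply/subgroupP; split=> [|g h [Hg [v vg Tv]] [Hh [w wh Tw]]].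
    split; first exact: subgroup1.
    by exists [::]; rewrite ?free_eval_nil.
  split; first exact: subgroupF.
  exists (v ++ word_inv w); first by rewrite free_eval_cat free_eval_inv vg wh.
  rewrite path_in_cat vg mul1g; split=> //.
  (* The reversed path of [w] starts at [h]; left translation by [g / h], an element of [H], moves
     its start to [g] and preserves the cosets visited. *)
  have := path_in_inv Tw; rewrite mul1g wh.
  apply: path_in_impl => x; rewrite -[g * x](divgKA h).
  by apply: on_tree_mull; apply: subgroupF.
have [_ [w wu Tw]] : K (ev u).
  by move: Hu; rewrite -SH; apply: smallest_sub.
have /free_reduction_congr := (free_eval_eqP freeF w u).1 wu.
rewrite (free_reduction_id ru) => <-.
exact: path_in_steps (rw_steps_free_reduction w) Tw.
Qed.

(** What irreducibility of [t u] gives: no free cancellation applies, and no prefix [p y] is the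
    left side of a tree rule. *)
Definition tree_normal T u : Prop :=
  reduced u /\ forall p y s w, u = rcons p y ++ s -> p \in T -> w \in T ->
    H (ev (rcons p y) / ev w) -> rcons p y \in T.

Lemma tree_normal_prefix T u v : tree_normal T (u ++ v) -> tree_normal T u.
Proof.
move=> [ruv nuv]; split; first exact: reduced_catl ruv.
by move=> p y s w us; apply: (nuv p y (s ++ v) w); rewrite us catA.
Qed.

(** By induction the prefix before the last letter lies in [T]; the last coset is on the tree, so
    normality puts the whole word in [T]. *)
Lemma tree_normal_on_tree T u : schreier_tree T ->
  tree_normal T u -> path_in i (on_tree T) 1 u -> u \in T.
Proof.
move=> [T0 _ _]; elim/last_ind: u => [//|u y IH] nuy Tuy.
have [w Tw] := path_in_end Tuy; rewrite mul1g => Huw.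
apply: (nuy.2 u y [::] w) => //; first by rewrite cats0.
move: nuy Tuy; rewrite -cats1 => /tree_normal_prefix nu.
by rewrite path_in_cat => -[Tu _]; apply: IH.
Qed.

(* If the last letters differ, [u v^-1] is a reduced word of [H], so the paths
   of [u] and [v] stay in the tree; otherwise that letter can be cancelled. *)
Lemma tree_normal_inj T u v : schreier_tree T ->
  (forall w, reduced w -> H (ev w) -> path_in i (on_tree T) 1 w) ->
  tree_normal T u -> tree_normal T v -> H (ev u / ev v) -> u = v.
Proof.
move=> treeT core.
have on_treeT u' v' : tree_normal T u' -> tree_normal T v' ->
    H (ev u' / ev v') ->
    (forall u1 v1 a, u' = rcons u1 a -> v' <> rcons v1 a) -> u' = v'.
  move=> nu nv Huv /(reduced_cat_inv nu.1 nv.1) ruv.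
  have HuvE : H (ev (u' ++ word_inv v')) by rewrite free_eval_cat free_eval_inv.
  have := core _ ruv HuvE; rewrite path_in_cat mul1g => -[Tu /path_in_inv].
  rewrite word_invK free_eval_inv => Tv.
  have [_ _ Tinj] := treeT; apply: Tinj => //; apply: tree_normal_on_tree => //.
  (* [Tv] follows [v'] from [ev u' / ev v']; the inverse of this element of [H] translates the start
     to [1]. *)
  apply: path_in_impl Tv => x; rewrite mul1g -{2}[x](mulKg (ev u' / ev v')).
  by apply: on_tree_mull; apply: subgroupV.
elim/last_ind: u v => [|u a IH] v nu nv Huv; last first.
  case: (pselect (exists v', v = rcons v' a)) => [[v' vE]|Nv].
    rewrite vE; congr rcons; apply: IH.
    - by move: nu; rewrite -cats1; apply: tree_normal_prefix.
    - by move: nv; rewrite vE -cats1; apply: tree_normal_prefix.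
    - by move: Huv; rewrite vE 2!free_eval_rcons mulgKA.
  apply: on_treeT nu nv Huv _ => u' v' b /rcons_inj[_ <-] vE.
  by apply: Nv; exists v'.
by apply: on_treeT nu nv Huv _ => u' v' b; case: u'.
Qed.

End SchreierTree.

(** * The rewriting rules attached to a Schreier tree *)

Section TreeRules.
Variables (X : finType) (F : groupType) (i : X -> F).
Variables (H : set F) (sH : subgroup H).
Variables (Z : finType) (e : Z -> F).
Local Notation Y := (signed_letter X).
Local Notation Ya := (signed_letter Z).
Local Notation E := (ext_alphabet Y Ya).
Local Notation ev := (free_eval i).
Variables (T : seq (word Y)) (treeT : schreier_tree i H T).
Variables (lift : F -> word Ya) (liftP : forall h, H h -> free_eval e (lift h) = h).

Definition tree_rule (p : word Y) (y : Y) (w : word Y) : word E * word E :=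
  (new_letter * word_inl (rcons p y),
   word_inr (lift (ev (rcons p y) / ev w)) * new_letter * word_inl w).

Definition tree_rules : rules E :=
  [set r | exists p y w, [/\ p \in T, rcons p y \notin T, w \in T,
     H (ev (rcons p y) / ev w) & r = tree_rule p y w]].

Lemma finite_tree_rules : finite_set tree_rules.
Proof.
pose s := [seq tree_rule py.1 py.2 w | py <- [seq (p, y) | p <- T, y <- enum Y],
                                       w <- T].
apply: (@sub_finite_set _ _ [set` s]); last exact: finite_seq.
move=> _ [p [y [w [Tp _ Tw _ ->]]]] /=.
apply/allpairsP; exists ((p, y), w); split=> //=.
by apply/allpairsP; exists (p, y); rewrite mem_enum.
Qed.

Lemma tree_rules_cost x y : rw_step (ext_rules (@free_rules X) tree_rules) x y ->
  tree_cost T None y < tree_cost T None x.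
Proof.
have [_ Tprefix _] := treeT.
apply: tree_cost_decreasing => // [p|_ [p [z [w [Tp Tpz Tw _ ->]]]]].
  exact: schreier_tree_reduced treeT.
by exists p, z, w, (lift (ev (rcons p z) / ev w)).
Qed.

Lemma tree_rules_eval r : tree_rules r ->
  exists (u w : word Y) (v : word Ya),
    r = (new_letter * word_inl u, word_inr v * new_letter * word_inl w) /\
    ev u = free_eval e v * ev w.
Proof.
move=> [p [y [w [_ _ _ Hpw ->]]]].
exists (rcons p y), w, (lift (ev (rcons p y) / ev w)); split=> //.
by rewrite liftP // mulgVK.
Qed.

Lemma tree_rules_normal u :
  rw_irreducible (ext_rules (@free_rules X) tree_rules) (new_letter * word_inl u) ->
  tree_normal i H T u.
Proof.
move=> irr.
(* Irreducibility excludes only steps to a different word; the strict drop in cost excludes a step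
   from a word to itself. *)
have nostep y :
    ~ rw_step (ext_rules (@free_rules X) tree_rules) (new_letter * word_inl u) y.
  move=> xy; apply: irr; exists y; split=> // yx.
  by have := tree_rules_cost xy; rewrite yx ltnn.
split=> [|p y s w us Tp Tw Hpw].
  apply/negPn/negP => /reducedPn[x1 [x2 [a uE]]].
  apply: (nostep (new_letter * word_inl (x1 ++ x2))).
  exists (new_letter * word_inl x1), (word_inl x2).
  exists (word_inl [:: a; flip a]), [::]; split.
  - left; exists ([:: a; flip a], [::]) => //.
    by apply/free_rulesP; exists a.
  - by rewrite uE /mul /= /word_inl map_cat -catA.
  - by rewrite /mul /= cats0 /word_inl map_cat.
apply/negPn/negP => Tpy; case: (nostep ((tree_rule p y w).2 * word_inl s)).
exists [::], (word_inl s), (tree_rule p y w).1, (tree_rule p y w).2; split=> //.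
  by right; exists p, y, w.
by rewrite us /mul /= /word_inl map_cat.
Qed.

End TreeRules.

(** * Left and right compatibility *)

Section Compatibility.
Variables (X : finType) (F : groupType) (i : X -> F) (freeF : free_group_on i).
Local Notation ev := (free_eval i).

(** Indexing the generators by an ordinal provides the finite alphabet [Ya] of signed indices; the
    values of its words form the subgroup generated. *)
Lemma finitely_generated_range (H : set F) : subgroup H -> finitely_generated H ->
  exists n (e : 'I_n -> F), range (free_eval e) = H.
Proof.
move=> sH [S [/finite_seqP[s Ss] SH]].
exists (size s), (tnth (in_tuple s)); apply/seteqP; split=> [_ [w _ <-]|].
  elim: w => [|a w IH]; first by rewrite free_eval_nil; apply: subgroup1.
  rewrite free_eval_cons; apply: subgroupM => //.
  have Ha : H (tnth (in_tuple s) a.1).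
    by rewrite -SH; apply: sub_gen_smallest; rewrite Ss /= mem_tnth.
  by case: ifP => _ //; apply: subgroupV.
rewrite -{1}SH; apply: smallest_sub.
  apply/subgroupP; split=> [|_ _ [u _ <-] [v _ <-]].
    by exists [::]; rewrite ?free_eval_nil.
  by exists (u ++ word_inv v); rewrite // free_eval_cat free_eval_inv.
move=> g; rewrite Ss /= => /(tnthP (in_tuple s))[k ->].
by exists [:: (k, true)]; rewrite // free_eval_cons free_eval_nil mulg1.
Qed.

Lemma free_rules_compatible (A : Type) (Fa : A -> set F) :
  (forall a, subgroup (Fa a)) -> (forall a, finitely_generated (Fa a)) ->
  left_compatible (@free_rules X) ev Fa /\ right_compatible (@free_rules X) ev Fa.
Proof.
(* One tree and one choice of words for the elements of [Fa a] serve both sides. *)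
move=> sFa fgFa; suff compat a : exists n (e : 'I_n -> F)
    (T : seq (word (signed_letter X))) (lift : F -> word (signed_letter 'I_n)),
    [/\ range (free_eval e) = Fa a, schreier_tree i (Fa a) T,
        forall u, reduced u -> Fa a (ev u) -> path_in i (on_tree i (Fa a) T) 1 u &
        forall h, Fa a h -> free_eval e (lift h) = h].
  split=> a; have [n [e [T [lift [rangee treeT core liftP]]]]] := compat a;
    have sH := sFa a.
    exists (signed_letter 'I_n), (free_eval e), (tree_rules i (Fa a) T lift).
    split.
    - by split=> //; apply: free_eval_monoid_morphism.
    - exact: finite_tree_rules.
    - by apply: rw_terminating_measure => x y; apply: tree_rules_cost.
    - exact: tree_rules_eval.
    move=> u v /(tree_rules_normal sH treeT) nu.
    move=> /(tree_rules_normal sH treeT) nv.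
    split=> [->//|/(right_coset_eqP sH)]; exact: (tree_normal_inj sH treeT core).
  exists (signed_letter 'I_n), (free_eval e).
  exists (mirror_rules (tree_rules i (Fa a) T lift)).
  split.
  - by split=> //; apply: free_eval_monoid_morphism.
  - exact/finite_image/finite_tree_rules.
  - apply/rw_terminating_mirror/rw_terminating_measure => x y.
    exact: tree_rules_cost.
  - move=> _ [r /(tree_rules_eval liftP)[u [w [v [-> uvw]]]] <-].
    exists (word_inv u), (word_inv w), (word_inv v); split; last first.
      by rewrite !free_eval_inv uvw invgM.
    by rewrite /mul /= -[None :: _]cat1s !ext_inv_cat !ext_inv_inl ext_inv_inr catA.
  move=> u v /rw_irreducible_mirror irru /rw_irreducible_mirror irrv.
  rewrite /mul /= ext_inv_cat ext_inv_inl in irru.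
  rewrite /mul /= ext_inv_cat ext_inv_inl in irrv.
  have nu := tree_rules_normal sH treeT irru.
  have nv := tree_rules_normal sH treeT irrv.
  split=> [->//|/(left_coset_eqP sH)]; rewrite -(free_eval_inv i u) -(free_eval_inv i v) => uv.
  (* The inverse words are the normal ones here, so their equality is proved and inverted back. *)
  apply: (can_inj (@word_invK X)); exact: (tree_normal_inj sH treeT core nu nv uv).
have [n [e rangee]] := finitely_generated_range (sFa a) (fgFa a).
have [T treeT core] := schreier_tree_core freeF (sFa a) (fgFa a).
have [lift liftP] : {lift : F -> word (signed_letter 'I_n) &
    forall h, Fa a h -> free_eval e (lift h) = h}.
  apply: (@choice _ _ (fun h w => Fa a h -> free_eval e w = h)) => h.
  (* Outside the subgroup the empty word is a default value. *)
  case: (pselect (Fa a h)) => [|NHh]; last by exists [::].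
  by rewrite -rangee => -[w _ wh]; exists w.
by exists n, e, T, lift.
Qed.

End Compatibility.

Theorem theorem3p1 (X : finType) (F : groupType) (i : X -> F)
    (freeF : free_group_on i) :
  finite_complete_rws_for (@free_rules X) (free_eval i) /\
  forall (A : finType) (Fa : A -> set F),
    (forall a, subgroup (Fa a)) ->
    (forall a, finitely_generated (Fa a)) ->
    left_compatible (@free_rules X) (free_eval i) Fa /\
    right_compatible (@free_rules X) (free_eval i) Fa.
Proof.
split; first exact: free_complete_rws.
by move=> A Fa; apply: free_rules_compatible.
Qed.
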